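(* Let $K$ be a field. Then there is a graded nil $K$-algebra with neither polynomial nor exponential growth. Moreover, this algebra is generated by two elements of degree one.
   Context: Algebras here are associative and not necessarily unital; a graded algebra is graded by the additive semigroup of natural numbers. An algebra is nil if each of its elements is nilpotent. For a graded algebra $R$ generated by finitely many elements of degree one, let $R_n$ be the $K$-linear space of elements of $R$ of degrees not exceeding $n$. $R$ has polynomial growth if there are constants $C,d>0$ with $\dim R_n\le C n^{d}$ for all $n\ge 1$; $R$ has exponential growth if there is $c>1$ with $\dim R_n> c^{n}$ for all sufficiently large $n$. *)

(* Defs.v *)
From HB Require Import structures.
From mathcomp Require Import all_boot all_order all_algebra.
From mathcomp Require Import all_classical all_reals all_analysis.

Set Implicit Arguments.
Unset Strict Implicit.
Unset Printing Implicit Defensive.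

Import Order.TTheory GRing.Theory Num.Theory.
Local Open Scope classical_set_scope.
Local Open Scope ring_scope.

(* Associative, not necessarily unital, [K]-algebras.  MathComp's own algebra
   structures all have a unit, so the product is that of its semigroups,
   written [(x * y)%g]; associativity is part of [Semigroup]. *)
HB.mixin Record Lmodule_Semigroup_isNUAlgebra (K : fieldType) A
    of GRing.Lmodule K A & Semigroup A := {
  numulDl : forall x y z : A, ((x + y)%R * z)%g = (x * z)%g + (y * z)%g;
  numulDr : forall x y z : A, (x * (y + z)%R)%g = (x * y)%g + (x * z)%g;
  numulZl : forall (k : K) (x y : A), ((k *: x)%R * y)%g = k *: (x * y)%g;
  numulZr : forall (k : K) (x y : A), (x * (k *: y)%R)%g = k *: (x * y)%g
}.

#[short(type="nuAlgType")]
HB.structure Definition NUAlgebra (K : fieldType) :=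
  {A of Lmodule_Semigroup_isNUAlgebra K A & GRing.Lmodule K A & Semigroup A}.

(* Without a unit only positive powers exist: [pospow a n] is [a ^ (n + 1)]. *)
Definition pospow (K : fieldType) (A : nuAlgType K) (a : A) (n : nat) : A :=
  iter n (fun b => (a * b)%g) a.

Definition nilpotent_elt (K : fieldType) (A : nuAlgType K) (a : A) : Prop :=
  exists n : nat, pospow a n = 0.

Definition nil_algebra (K : fieldType) (A : nuAlgType K) : Prop :=
  forall a : A, nilpotent_elt a.

Definition subalgebra (K : fieldType) (A : nuAlgType K) (S : {pred A}) : Prop :=
  GRing.submod_closed S /\ {in S &, forall u v, (u * v)%g \in S}.

Definition generated_by2 (K : fieldType) (A : nuAlgType K) (x y : A) : Prop :=
  forall S : {pred A}, subalgebra S -> x \in S -> y \in S ->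
    forall a : A, a \in S.

(* [A] is the internal direct sum of the subspaces [G 0], [G 1], ..., and
   [G i * G j] is contained in [G (i + j)].  Degree 0 is allowed. *)
Definition grading (K : fieldType) (A : nuAlgType K) (G : nat -> {pred A}) :
    Prop :=
  [/\ forall i, GRing.submod_closed (G i),
      forall i j, {in G i & G j, forall u v, (u * v)%g \in G (i + j)%N},
      forall a : A, exists (n : nat) (f : nat -> A),
        (forall i, f i \in G i) /\ a = \sum_(i < n) f i
    & forall (n : nat) (f : nat -> A), (forall i, f i \in G i) ->
        \sum_(i < n) f i = 0 -> forall i, (i < n)%N -> f i = 0].

Definition degree_le (K : fieldType) (A : nuAlgType K) (G : nat -> {pred A})
    (n : nat) : set A :=
  [set a | exists f : nat -> A,
    (forall i, f i \in G i) /\ a = \sum_(i < n.+1) f i].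

Definition has_dim (K : fieldType) (V : lmodType K) (W : set V) (m : nat) :
    Prop :=
  exists b : 'I_m -> V,
    (forall c : 'I_m -> K, \sum_i c i *: b i = 0 -> forall i, c i = 0) /\
    W = [set v | exists c : 'I_m -> K, v = \sum_i c i *: b i].

(* Meaningful only for a finite-dimensional subspace [W] (the value is 0
   otherwise); the spaces [degree_le G n] are finite-dimensional as soon as [A]
   is generated by finitely many elements of degree one. *)
Definition dimension (K : fieldType) (V : lmodType K) (W : set V) : nat :=
  get [set m | has_dim W m].

Definition polynomial_growth (R : realType) (K : fieldType) (A : nuAlgType K)
    (G : nat -> {pred A}) : Prop :=
  exists C d : R, [/\ 0 < C, 0 < d &
    forall n : nat, (1 <= n)%N ->
      (dimension (degree_le G n))%:R <= C * n%:R `^ d].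

Definition exponential_growth (R : realType) (K : fieldType) (A : nuAlgType K)
    (G : nat -> {pred A}) : Prop :=
  exists c : R, 1 < c /\
    \forall n \near \oo, c ^+ n < (dimension (degree_le G n))%:R.

(* Main.v *)
(** Let [F] be the free algebra on two generators, with words as a basis.  We
choose lengths [q_0 = 1], [q_1], ... with [q_k] dividing [q_(k+1)], and for each
[k] a rule that reduces every word of length [q_k] to a combination of only two
of them.  Applying the rules to the factors of a word that occupy the positions
[i * q_k, ..., (i + 1) * q_k - 1] gives a right ideal [J] of [F], and the algebra
is [F / Ann (F / J)].  The proof works with the dual of [F / J]: the functions on
words that are compatible with all the rules.

A product of words of length [q_k] only depends on the two-letter word of the
representatives, so dimensions grow at most like [2 ^ (n / q_k)] up to a constant,
for every [k]: the growth is subexponential.  The rules of level [k + 1] do not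
touch words shorter than [q_(k+1)], so dimensions reach [2 ^ (q_(k+1) / q_k - 1)]
before degree [q_(k+1)]: the growth is superpolynomial if the ratios are large.

For nilpotency, the rule of level [k + 1] is chosen so that [w * a ^ N] vanishes
at the beginning of a block whenever [a] has no constant term and degree at most
[k], and [w] is a word shorter than [k].  This is a system of linear equations: as
a multihomogeneous form in the coefficients of [a], the power [a ^ N] involves
only polynomially many monomials in [N], each one costs a fraction [2 ^ (- N / q_k)]
of the space, so for large [N] a nonzero solution is left.  Finally, a long power
of [a] applied after any word must cross a block boundary, and just after crossing
it the position is less than [k] away from the boundary. *)

Require Import Defs.
From HB Require Import structures.
From mathcomp Require Import all_boot all_order all_algebra.
From mathcomp Require Import all_classical all_reals all_analysis.
From mathcomp Require Import zify ring lra.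

Set Implicit Arguments.
Unset Strict Implicit.
Unset Printing Implicit Defensive.

Import Order.TTheory GRing.Theory Num.Theory.
Local Open Scope ring_scope.

(** * Words *)

(** With [r = t %/ s.+1], one has [t <= s.+1 * 2 ^ r] and [A * s.+1 ^ s < 2 ^ r], so [A * t ^ s] is
    less than [2 ^ (r + r * s) <= 2 ^ t]. *)
Lemma exp2_dominates_pow (A s t : nat) :
  (s.+1 * (A * s.+1 ^ s) <= t)%N -> (A * t ^ s < 2 ^ t)%N.
Proof.
move=> le_t; set r := (t %/ s.+1)%N.
have le_r : (A * s.+1 ^ s <= r)%N by rewrite leq_divRL // mulnC.
have t_le : (t <= s.+1 * 2 ^ r)%N.
  rewrite (leq_trans (ltnW (ltn_ceil t (ltn0Sn s)))) // mulnC leq_mul2l /=.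
  exact: ltn_expl.
apply: (@leq_ltn_trans (A * s.+1 ^ s * 2 ^ (r * s))%N).
  rewrite -mulnA leq_mul2l expnM -expnMn.
  apply/orP; right; case: (posnP s) => [->|s_gt0]; first by rewrite !expn0.
  by rewrite leq_exp2r.
apply: (@leq_trans (2 ^ r * 2 ^ (r * s))%N).
  by rewrite ltn_mul2r expn_gt0 /= (leq_ltn_trans le_r) // ltn_expl.
rewrite -expnD leq_exp2l // -mulnS; exact: leq_trunc_div.
Qed.

Fixpoint words_lt (n : nat) : seq (seq bool) :=
  if n is n'.+1 then [::] :: [seq b :: u | b <- [:: true; false], u <- words_lt n']
  else [::].

Lemma size_words_lt n : (size (words_lt n) < 2 ^ n)%N.
Proof.
elim: n => //= n IHn.
rewrite cats0 !size_cat !size_map expnS; lia.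
Qed.

Lemma mem_words_lt n u : (u \in words_lt n) = (size u < n)%N.
Proof.
elim: n u => [|n IHn] [|b u] //.
rewrite -[words_lt n.+1]/([::] :: [seq c :: v | c <- [:: true; false], v <- words_lt n]).
rewrite inE orFb ltnS; apply/allpairsP/idP => [[[c v] [_ /= vP [_ ->]]]|ltu].
  by rewrite -IHn.
by exists (b, u); rewrite IHn /=; split=> //; case: (b).
Qed.

Lemma uniq_words_lt n : uniq (words_lt n).
Proof.
elim: n => //= n IHn; rewrite cats0 cat_uniq !map_inj_uniq ?IHn /=; last 2 first.
- by move=> ? ? [].
- by move=> ? ? [].
rewrite andbT mem_cat; apply/andP; split.
  by apply/negP => /orP[] /mapP[].
by apply/hasPn => _ /mapP[u _ ->]; apply/mapP => -[].
Qed.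

(** * Block reductions *)

Lemma dropl_cat (T : Type) (n : nat) (s t : seq T) :
  (n <= size s)%N -> drop n (s ++ t) = drop n s ++ t.
Proof.
rewrite leq_eqVlt drop_cat => /orP[/eqP ->|->//].
by rewrite ltnn subnn drop0 drop_size.
Qed.

Section Blocks.
Variable K : fieldType.

(* The reduction rule of one level: a word [x] of length [blen] is to be replaced
   by the sum over [b] of [bcoef b x] times the word [brep b]. *)
Record block := Block {
  blen : nat;
  bcoef : bool -> seq bool -> K;
  brep : bool -> seq bool;
  blen_gt0 : (0 < blen)%N;
  size_brep : forall b, size (brep b) = blen;
  bcoef_out : forall b x, size x != blen -> bcoef b x = 0;
  bcoef_rep : forall b c, bcoef b (brep c) = (b == c)%:R }.

(* [F], extended linearly, factors through the reduction of the blocks of [S]. *)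
Definition aligned (S : block) (F : seq bool -> K) : Prop :=
  forall u x v, (blen S %| size u)%N -> size x = blen S ->
    F (u ++ x ++ v) = \sum_b bcoef S b x * F (u ++ brep S b ++ v).

(* [nf S e s y] is the coefficient of [rep S e ++ s] in the reduction of [y]. *)
Fixpoint nf (S : block) (e s y : seq bool) : K :=
  if e is b :: e' then bcoef S b (take (blen S) y) * nf S e' s (drop (blen S) y)
  else (y == s)%:R.

Definition rep (S : block) (e : seq bool) : seq bool := flatten (map (brep S) e).

Lemma size_rep S e : size (rep S e) = (size e * blen S)%N.
Proof. by elim: e => //= b e IHe; rewrite size_cat size_brep IHe mulSn. Qed.

Lemma nf_out S e s y : size y != (size e * blen S + size s)%N -> nf S e s y = 0.
Proof.
elim: e y => [|b e IHe] y /= ne_y.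
  by rewrite (_ : (y == s) = false) //; apply: contraNF ne_y => /eqP ->.
have [lt_y|le_y] := ltnP (size y) (blen S).
  by rewrite bcoef_out ?mul0r // take_oversize; lia.
by rewrite IHe ?mulr0 // size_drop; move: ne_y; rewrite mulSn; lia.
Qed.

Lemma nf_rep S e g s t : size e = size g ->
  nf S e s (rep S g ++ t) = ((e == g) && (t == s))%:R.
Proof.
elim: e g => [|b e IHe] [|c g] //= [eq_eg].
rewrite -catA take_size_cat ?drop_size_cat ?size_brep // bcoef_rep IHe //.
by rewrite eqseq_cons -natrM mulnb andbA.
Qed.

Lemma nf_rcons S e b y :
  nf S (rcons e b) [::] y =
  nf S e [::] (take (size e * blen S) y) * bcoef S b (drop (size e * blen S) y).
Proof.
elim: e y => [|c e IHe] y /=.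
  rewrite mul0n take0 drop0 eqxx mul1r.
  have [le_y|gt_y] := leqP (size y) (blen S).
    by rewrite take_oversize // drop_oversize // eqxx mulr1.
  rewrite [in RHS]bcoef_out ?gtn_eqF // -size_eq0 size_drop.
  by rewrite gtn_eqF ?mulr0 // subn_gt0.
rewrite IHe mulSn mulrA drop_drop addnC; congr (_ * _ * _).
  by rewrite -take_min (minn_idPl _) ?leq_addr.
by rewrite take_drop addnC.
Qed.

(** Reducing a block first does not change the normal form: for the first block this is the duality
    [bcoef_rep], for later blocks induction. *)
Lemma aligned_nf S e : aligned S (nf S e [::]).
Proof.
elim: e => [|b e IHe] u x v q_u sz_x.
  rewrite big1 => [|b _] /=; rewrite -size_eq0 !size_cat ?sz_x ?size_brep;
  by have := blen_gt0 S; case: (blen S) => // n _; rewrite ?addnS ?mulr0.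
have [->|u_neq0] := eqVneq u [::].
  rewrite !cat0s (bigD1 b) //= big1 => [|c /negPf c_neq]; rewrite !take_size_cat ?size_brep //.
    by rewrite addr0 !drop_size_cat ?size_brep // bcoef_rep eqxx mul1r.
  by rewrite bcoef_rep eq_sym c_neq mul0r mulr0.
have le_q : (blen S <= size u)%N by rewrite dvdn_leq // lt0n size_eq0.
rewrite /= takel_cat // dropl_cat // IHe ?size_drop ?dvdn_sub //.
rewrite mulr_sumr; apply: eq_bigr => c _.
by rewrite takel_cat // dropl_cat // mulrCA.
Qed.

Lemma aligned_sum S (I : eqType) (r : seq I) (c : I -> K)
    (F : I -> seq bool -> K) :
  (forall i, i \in r -> aligned S (F i)) ->
  aligned S (fun y => \sum_(i <- r) c i * F i y).
Proof.
move=> alF u x v q_u sz_x.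
under eq_big_seq => i ri do rewrite (alF i ri) // mulr_sumr.
rewrite exchange_big; apply: eq_bigr => b _; rewrite mulr_sumr.
by apply: eq_bigr => i _; rewrite mulrCA.
Qed.

Lemma aligned_catl S F u0 : (blen S %| size u0)%N -> aligned S F ->
  aligned S (fun y => F (u0 ++ y)).
Proof.
move=> q_u0 alF u x v q_u sz_x; rewrite [u0 ++ _]catA alF ?size_cat ?dvdn_add //.
by apply: eq_bigr => b _; rewrite -catA.
Qed.

Lemma aligned_catr S F v0 : aligned S F -> aligned S (fun y => F (y ++ v0)).
Proof.
move=> alF u x v q_u sz_x; rewrite -!catA alF //.
by apply: eq_bigr => b _; rewrite -!catA.
Qed.

(** Reducing the blocks one by one leaves only products of representatives. Relations thus need to
    be imposed on [2 ^ j] words only. *)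
Lemma aligned_vanish S F j : aligned S F ->
  (forall g, size g = j -> F (rep S g) = 0) ->
  forall y, size y = (j * blen S)%N -> F y = 0.
Proof.
elim: j F => [|j IHj] F alF F0 y sz_y.
  by rewrite (size0nil sz_y); apply: (F0 [::]).
rewrite -(cat_take_drop (blen S) y) -[_ ++ _]cat0s alF ?size_takel ?sz_y //; last first.
  by rewrite mulSn leq_addr.
apply: big1 => b _.
rewrite (IHj (fun z => F (brep S b ++ z))) ?mulr0 ?size_drop ?sz_y ?mulSn ?addKn //.
  by apply: aligned_catl; rewrite ?size_brep.
by move=> g sz_g; rewrite -(F0 (b :: g)) //= sz_g.
Qed.

(** All full blocks of [y] are reduced and a remainder [s] is kept. Summing over every [e] and [s]
    is harmless, as [nf] vanishes on wrong lengths. *)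
Lemma aligned_expand S F Q y : aligned S F -> (size y < Q * blen S)%N ->
  F y = \sum_(e <- words_lt Q) \sum_(s <- words_lt (blen S))
          nf S e s y * F (rep S e ++ s).
Proof.
elim: Q F y => [|Q IHQ] F y alF; first by rewrite mul0n.
rewrite mulSn => lt_y.
rewrite -[words_lt Q.+1]/([::] :: [seq b :: u | b <- [:: true; false], u <- words_lt Q]).
rewrite big_cons big_allpairs_dep /=.
have [lt_yq|le_qy] := ltnP (size y) (blen S).
  rewrite [X in _ + X]big1_seq => [|b _]; last first.
    rewrite big1_seq // => e _; rewrite big1_seq // => s _ /=.
    by rewrite take_oversize ?(ltnW lt_yq) // bcoef_out ?(ltn_eqF lt_yq) // !mul0r.
  rewrite addr0 (bigD1_seq y) ?mem_words_lt ?uniq_words_lt //= eqxx mul1r big1 ?addr0 //.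
  by move=> s /negPf s_neq; rewrite eq_sym s_neq mul0r.
rewrite big1_seq ?add0r => [|s /andP[_]]; last first.
  by rewrite mem_words_lt; case: eqP => [<-|_]; rewrite ?mul0r // ltnNge le_qy.
rewrite -{1}(cat_take_drop (blen S) y) -[_ ++ _]cat0s alF ?size_takel //.
have step b : bcoef S b (take (blen S) y) * F ([::] ++ brep S b ++ drop (blen S) y) =
    \sum_(e <- words_lt Q) \sum_(s <- words_lt (blen S))
      nf S (b :: e) s y * F (rep S (b :: e) ++ s).
  rewrite cat0s (IHQ (fun z => F (brep S b ++ z))); last 2 first.
  - by apply: aligned_catl; rewrite ?size_brep.
  - by rewrite size_drop; lia.
  rewrite mulr_sumr; apply: eq_bigr => e _; rewrite mulr_sumr.
  by apply: eq_bigr => s _; rewrite /= mulrA -catA.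
by rewrite big_bool !big_cons big_nil addr0 !step.
Qed.

(** An aligned block of [T] lies inside one aligned block of [S]. Expanding [F] by the rule of [S]
    moves the replacement into [bcoef S], where the rule of [T] is respected. *)
Lemma aligned_trans S T F : (blen T %| blen S)%N ->
  (forall b, aligned T (bcoef S b)) -> aligned S F ->
  (forall y, ~~ (blen S %| size y)%N -> F y = 0) -> aligned T F.
Proof.
move=> TS alT alS F_out u x v q_u sz_x.
have [q_uxv|nq_uxv] := boolP (blen S %| size (u ++ x ++ v))%N; last first.
  rewrite F_out // big1 // => b _; rewrite F_out ?mulr0 //.
  by move: nq_uxv; rewrite !size_cat size_brep sz_x.
pose p := (size u %/ blen S * blen S)%N.
pose u1 := take p u; pose u2 := drop p u.
have sz_u1 : size u1 = p by rewrite size_takel // leq_trunc_div.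
have lt_u2 : (size u2 < blen S)%N.
  by rewrite size_drop {1}(divn_eq (size u) (blen S)) addKn ltn_mod blen_gt0.
have q_u2 : (blen T %| size u2)%N.
  by rewrite size_drop dvdn_sub // dvdn_mull.
have le_u2x : (size u2 + size x <= blen S)%N.
  rewrite sz_x; case/dvdnP: TS lt_u2 => m ->; case/dvdnP: q_u2 => l ->.
  by rewrite ltn_mul2r => /andP[_ lt_lm]; rewrite -mulSnr leq_mul2r lt_lm orbT.
have le_all : (blen S <= size u2 + size x + size v)%N.
  apply: dvdn_leq; first by rewrite sz_x addn_gt0 addn_gt0 blen_gt0 orbT.
  move: q_uxv; rewrite -{1}(cat_take_drop p u) -catA size_cat -/u1 sz_u1 -/u2.
  by rewrite dvdn_addr ?dvdn_mull // !size_cat addnA.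
(* The first [r] letters of [v] complete the block of [S] around [x]; the support condition on [F]
   ensures that [v] has that many. *)
pose r := (blen S - (size u2 + size x))%N.
have split_at z : size z = blen T ->
    F (u ++ z ++ v) = \sum_b bcoef S b (u2 ++ z ++ take r v) * F (u1 ++ brep S b ++ drop r v).
  move=> sz_z; rewrite -{1}(cat_take_drop p u) -/u1 -/u2 -{1}(cat_take_drop r v).
  rewrite -catA [z ++ _]catA [u2 ++ _]catA alS ?sz_u1 ?dvdn_mull //.
  by rewrite !size_cat sz_z -sz_x size_takel ?leq_subLR // addnA subnKC.
rewrite split_at //.
under eq_bigr => b _ do rewrite alT // mulr_suml.
rewrite exchange_big; apply: eq_bigr => c _ /=.
rewrite split_at ?size_brep // mulr_sumr.
by apply: eq_bigr => b _; rewrite mulrA.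
Qed.

End Blocks.

(** * Killing powers at the start of a block *)

Section Step.
Variable K : fieldType.

(* A list [p] of weighted words stands for the element of the free algebra that is
   their sum; [act p] is the translate by it. *)
Definition act (p : seq (K * seq bool)) (f : seq bool -> K) (u : seq bool) : K :=
  \sum_(t <- p) t.1 * f (u ++ t.2).

Definition degrees_in (n : nat) (p : seq (K * seq bool)) : bool :=
  all (fun t => 0 < size t.2 <= n)%N p.

Definition letters (n : nat) : seq (seq bool) :=
  [seq z <- words_lt n.+1 | z != [::]].

Lemma mem_letters n z : (z \in letters n) = (0 < size z <= n)%N.
Proof. by rewrite mem_filter mem_words_lt ltnS lt0n size_eq0. Qed.

(** Equal words are collected, so that all lists of bounded degree become coefficient vectors over
    one finite alphabet of words. *)
Lemma act_letters n p : degrees_in n p ->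
  exists a : seq bool -> K,
    forall f u, act p f u = \sum_(z <- letters n) a z * f (u ++ z).
Proof.
move=> /allP p_n; exists (fun z => \sum_(t <- p | t.2 == z) t.1) => f u.
under [RHS]eq_bigr => z _ do rewrite mulr_suml.
rewrite (exchange_big_dep xpredT) //=; apply: eq_big_seq => t pt.
rewrite big_mkcond (bigD1_seq t.2) ?mem_letters ?p_n ?filter_uniq ?uniq_words_lt //=.
by rewrite eqxx big1 ?addr0 // => z /negPf; rewrite eq_sym => ->.
Qed.

Fixpoint tuples (Z : seq (seq bool)) (N : nat) : seq (seq (seq bool)) :=
  if N is N'.+1 then [seq z :: zs | z <- Z, zs <- tuples Z N'] else [:: [::]].

Lemma tuplesP Z N zs : zs \in tuples Z N -> size zs = N /\ {subset zs <= Z}.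
Proof.
elim: N zs => [|N IHN] zs /=; first by rewrite inE => /eqP ->.
case/allpairsP => -[z ys] [/= Zz /IHN[<- sub] ->]; split=> // x.
by rewrite inE => /orP[/eqP -> //|/sub].
Qed.

Lemma iter_act Z a p N f u :
    (forall f u, act p f u = \sum_(z <- Z) a z * f (u ++ z)) ->
  iter N (act p) f u =
  \sum_(zs <- tuples Z N) (\prod_(z <- zs) a z) * f (u ++ flatten zs).
Proof.
move=> actE; elim: N u => [|N IHN] u.
  by rewrite big_seq1 big_nil mul1r cats0.
rewrite iterS actE big_allpairs_dep /=; apply: eq_bigr => z _.
rewrite IHN mulr_sumr; apply: eq_bigr => zs _.
by rewrite big_cons mulrA catA.
Qed.

(** The exponent vector of the monomial attached to [zs]; [inord] truncates nothing on tuples of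
    length [N]. *)
Definition letter_count (Z : seq (seq bool)) (N : nat) (zs : seq (seq bool)) :
    {ffun 'I_(size Z) -> 'I_N.+1} :=
  [ffun j : 'I_(size Z) => inord (count_mem (nth [::] Z j) zs)].

Lemma letter_count_perm Z N zs ys : zs \in tuples Z N -> ys \in tuples Z N ->
  letter_count Z N zs = letter_count Z N ys -> perm_eq zs ys.
Proof.
move=> /tuplesP[sz_zs sub_zs] /tuplesP[sz_ys sub_ys] eq_c.
apply/allP => x; rewrite mem_cat => x_in.
have Zx : x \in Z by case/orP: x_in => [/sub_zs|/sub_ys].
have := congr1 (fun c : {ffun _ -> _} => val (c (Ordinal (etrans (index_mem x Z) Zx)))) eq_c.
rewrite !ffunE /= nth_index // !inordK ?ltnS -?{1}sz_zs -?{1}sz_ys ?count_size //.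
  by move=> ->.
by rewrite sz_zs -sz_ys count_size.
Qed.

Lemma letter_count_size Z N zs ys : zs \in tuples Z N -> ys \in tuples Z N ->
  letter_count Z N zs = letter_count Z N ys -> size (flatten zs) = size (flatten ys).
Proof.
move=> zsN ysN /(letter_count_perm zsN ysN) pe.
by rewrite !size_flatten; apply: perm_sumn; apply: perm_map.
Qed.

(* Tuples with the same letter counts carry the same monomial in the coefficients [a]. *)
Lemma letter_count_vanish Z N (h : seq bool -> K) (a : seq bool -> K) :
  (forall al, \sum_(zs <- tuples Z N | letter_count Z N zs == al) h (flatten zs) = 0) ->
  \sum_(zs <- tuples Z N) (\prod_(z <- zs) a z) * h (flatten zs) = 0.
Proof.
move=> h0; rewrite (partition_big (letter_count Z N) xpredT) //=.
apply: big1 => al _; rewrite big_seq_cond.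
have [/hasP[ys ysN /eqP c_ys]|no] := boolP (has (fun zs => letter_count Z N zs == al) (tuples Z N)).
  transitivity ((\prod_(z <- ys) a z) *
      \sum_(zs <- tuples Z N | letter_count Z N zs == al) h (flatten zs)); last by rewrite h0 mulr0.
  rewrite -big_seq_cond mulr_sumr big_seq_cond [RHS]big_seq_cond.
  apply: eq_bigr => zs /andP[zsN /eqP c_zs].
  by rewrite (perm_big ys) //; apply: (letter_count_perm zsN ysN); rewrite c_ys.
rewrite big1 // => zs /andP[zsN c_zs].
by case/hasP: no; exists zs.
Qed.

(** More unknowns than equations: a nonzero kernel vector, divided by one of its nonzero entries. *)
Lemma underdetermined (E : finType) (T : eqType) (C : seq T) (B : E -> T -> K) :
  (size C < #|E|)%N ->
  exists c : E -> K, (exists e, c e = 1) /\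
    forall x, x \in C -> \sum_e c e * B e x = 0.
Proof.
move=> ltCE.
pose M := \matrix_(i < #|E|, j < size C) B (enum_val i) (tnth (in_tuple C) j).
have : kermx M != 0.
  by rewrite kermx_eq0 -row_leq_rank -ltnNge (leq_ltn_trans (rank_leq_col M)).
case/rowV0Pn => v /sub_kermxP vM /rV0Pn[i0 vi0].
exists (fun e => v 0 (enum_rank e) / v 0 i0); split.
  by exists (enum_val i0); rewrite enum_valK divff.
move=> x Cx; have /tnthP[j ->] : x \in in_tuple C by [].
have := congr1 (fun A : 'rV_(size C) => A 0 j / v 0 i0) vM.
rewrite !mxE mul0r mulr_suml => vM0; rewrite -[RHS]vM0.
rewrite (reindex (@enum_val E E)) /=; last exact/onW_bij/enum_val_bij.
by apply: eq_bigr => i _; rewrite enum_valK mxE mulrAC.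
Qed.

(* Only offsets [size w < n] from the start of a block need to be killed. *)
Definition step (n : nat) (S T : block K) : Prop :=
  [/\ exists2 m, blen T = (m.+1 * blen S)%N & (blen S <= m)%N,
      forall b, aligned S (bcoef T b)
    & exists2 N, (n + n * N <= blen T)%N &
      forall p w y b, degrees_in n p -> (size w < n)%N ->
        iter N (act p) (fun x => bcoef T b (x ++ y)) w = 0].

End Step.

(** * Existence of the next rule, by counting equations *)

Section StepExists.
Variables (K : fieldType) (S : block K) (n : nat).
Let q := blen S.
Let Z := letters n.

Lemma size_flatten_letters N zs : zs \in tuples Z N ->
  (N <= size (flatten zs) <= n * N)%N.
Proof.
elim: N zs => [|N IHN] zs; first by rewrite inE => /eqP ->; rewrite muln0.
case/allpairsP => -[z ys] [/= Zz /IHN ys_N ->]; rewrite size_cat.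
case/andP: ys_N => ge_ys le_ys; move: Zz; rewrite mem_letters => /andP[z_gt0 le_z].
by rewrite mulnS leq_add // -add1n leq_add.
Qed.

(** For [N = q * t], the left side times [2 ^ (m - t)] will bound the number of relations, against
    [2 ^ m] unknowns. *)
Lemma step_parameter : exists2 t, (0 < t)%N &
  (2 ^ (n + q).+1 * (q * t).+1 ^ size Z < 2 ^ t)%N.
Proof.
pose A := (2 ^ (n + q).+1 * q.+1 ^ size Z)%N; pose s := size Z.
pose t := (s.+1 * (A * s.+1 ^ s))%N.
have t_gt0 : (0 < t)%N by rewrite !muln_gt0 !expn_gt0.
exists t => //; apply: leq_ltn_trans (exp2_dominates_pow (leqnn t)).
rewrite -mulnA leq_mul2l -expnMn; apply/orP; right.
have [->|s_gt0] := posnP (size Z); first by rewrite !expn0.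
by rewrite leq_exp2r // mulSn -add1n leq_add.
Qed.

(* The new coefficients are those of [chi] on the first [m] blocks of [S], where
   the nilpotency relations are imposed, times those of [S] on the last block;
   this last factor is what leaves two independent coefficient functions. *)
Section Coefficients.
Variables (t m : nat) (c : m.-tuple bool -> K).
Let N := (q * t)%N.
Hypothesis mE : m = (n + n * N + t)%N.

Let chi y := \sum_(e : m.-tuple bool) c e * nf S e [::] y.

Hypothesis c_kills : forall w al y g,
  (size w < n)%N -> (size y < q)%N -> (size g <= m - t)%N ->
  \sum_e c e * (\sum_(zs <- tuples Z N | letter_count Z N zs == al)
    nf S e [::] (w ++ flatten zs ++ y ++ rep S g)) = 0.

(** Extends the relations to arbitrary tails [y]. Tuples with equal letter counts have equal total
    length, so the blocks of [y] sit at the same boundaries in all terms and [aligned_vanish]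
    applies to the whole sum. *)
Lemma chi_vanish w al y : (size w < n)%N ->
  \sum_(zs <- tuples Z N | letter_count Z N zs == al) chi (w ++ flatten zs ++ y) = 0.
Proof.
move=> lt_w; rewrite -big_filter; set r := [seq zs <- _ | _].
have r_mem zs : zs \in r -> letter_count Z N zs = al /\ zs \in tuples Z N.
  by rewrite mem_filter => /andP[/eqP].
have [->|[zs0 rzs0]] : r = [::] \/ exists zs0, zs0 \in r.
  by case: (r) => [|zs0 r']; [left|right; exists zs0; rewrite inE eqxx].
  by rewrite big_nil.
have [c_zs0 zs0N] := r_mem _ rzs0.
pose L := size (flatten zs0).
have r_size zs : zs \in r -> size (flatten zs) = L.
  by move=> /r_mem[c_zs zsN]; apply: (letter_count_size zsN zs0N); rewrite c_zs.
have /andP[le_NL le_Ln] := size_flatten_letters zs0N.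
have [tot|tot] := eqVneq (size w + L + size y)%N (m * q)%N; last first.
  apply: big1_seq => zs /andP[_ /r_size sz_zs]; apply: big1 => e _.
  by rewrite nf_out ?mulr0 // !size_cat sz_zs size_tuple addn0 addnA.
(* The remainder [k] is taken from the front of [y]: the total length is [m * q], so the last [j]
   blocks are aligned. *)
pose j := (size y %/ q)%N; pose k := (size y %% q)%N.
have szy : size y = (j * q + k)%N by rewrite /j /k -divn_eq.
have lt_kq : (k < q)%N by rewrite ltn_mod blen_gt0.
(* The [N] nonempty factors occupy at least [t * q] positions; saving these [t] blocks is what keeps
   the relations fewer than the unknowns. *)
have le_j : (j <= m - t)%N.
  have : ((j + t) * q <= m * q)%N.
    rewrite -tot szy mulnDl; have : (t * q <= L)%N by rewrite mulnC.
    lia.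
  by rewrite leq_pmul2r ?blen_gt0 //; lia.
pose F x := \sum_(zs <- r) 1 * chi (w ++ flatten zs ++ take k y ++ x).
have alF : aligned S F.
  apply: aligned_sum => zs /r_size sz_zs.
  have -> : (fun x => chi (w ++ flatten zs ++ take k y ++ x)) =
            (fun x => chi ((w ++ flatten zs ++ take k y) ++ x)).
    by apply/funext => x; rewrite -!catA.
  apply: (@aligned_catl _ S chi).
    rewrite !size_cat sz_zs size_takel ?leq_mod //.
    have -> : (size w + (L + k) = (m - j) * q)%N by rewrite mulnBl -tot szy; lia.
    exact: dvdn_mull.
  by apply: aligned_sum => e _; apply: aligned_nf.
have F0 g : size g = j -> F (rep S g) = 0.
  move=> sz_g; rewrite /F; under eq_bigr => zs _ do rewrite mul1r.
  rewrite exchange_big -[RHS](c_kills (y := take k y) (g := g) al lt_w).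
  - by apply: eq_bigr => e _; rewrite -mulr_sumr /r big_filter.
  - by rewrite size_takel ?leq_mod.
  - by rewrite sz_g.
have := aligned_vanish alF F0 (y := drop k y).
rewrite size_drop {1}szy addnK => /(_ erefl) Fy0; rewrite -[RHS]Fy0 /F.
by apply: eq_bigr => zs _; rewrite cat_take_drop mul1r.
Qed.

Variable e0 : m.-tuple bool.
Hypothesis c_e0 : c e0 = 1.

Let coef b y := \sum_(e : m.-tuple bool) c e * nf S (rcons e b) [::] y.
Let rp b := rep S (rcons e0 b).

Let coefE b y : coef b y = chi (take (m * q) y) * bcoef S b (drop (m * q) y).
Proof.
rewrite /coef /chi mulr_suml; apply: eq_bigr => e _.
by rewrite nf_rcons size_tuple mulrA.
Qed.

(** The normalization [c e0 = 1] gives duality with the representatives [rp]. As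
    [n + n * N <= m * q], the offset and the power fit into the first [m] blocks, where [chi_vanish]
    applies. *)
Lemma step_of_coefficients : (q <= m)%N -> exists T, step n S T.
Proof.
move=> le_qm.
have len_gt0 : (0 < m.+1 * q)%N by rewrite muln_gt0 blen_gt0.
have size_rp b : size (rp b) = (m.+1 * q)%N by rewrite size_rep size_rcons size_tuple.
have coef_out b x : size x != (m.+1 * q)%N -> coef b x = 0.
  move=> ne_x; apply: big1 => e _.
  by rewrite nf_out ?mulr0 // size_rcons size_tuple addn0.
have coef_rp b d : coef b (rp d) = (b == d)%:R.
  have nfE (e : m.-tuple bool) : nf S (rcons e b) [::] (rp d) = ((e == e0) && (b == d))%:R.
    rewrite -[rp d]cats0 nf_rep; last by rewrite !size_rcons !size_tuple.
    by rewrite eqseq_rcons eqxx andbT.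
  rewrite /coef (bigD1 e0) //= big1 => [|e /negPf e_neq].
    by rewrite nfE eqxx c_e0 mul1r addr0.
  by rewrite nfE e_neq mulr0.
exists (Block len_gt0 size_rp coef_out coef_rp); split; first by exists m.
  by move=> b; apply: aligned_sum => e _; apply: aligned_nf.
have le_len : (n + n * N <= m * q)%N.
  by rewrite (leq_trans _ (leq_pmulr _ (blen_gt0 S))) // mE leq_addr.
exists N => [|p w y b p_n lt_w] /=.
  by rewrite (leq_trans le_len) // leq_mul2r leqnSn orbT.
have [a actE] := act_letters p_n.
rewrite (iter_act _ _ _ actE).
apply: (letter_count_vanish (h := fun x => coef b ((w ++ x) ++ y))) => al.
rewrite big_seq_cond.
have [/hasP[ys ysN /eqP c_ys]|no] :=
    boolP (has (fun zs => letter_count Z N zs == al) (tuples Z N)); last first.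
  rewrite big1 // => zs /andP[zsN c_zs].
  by case/hasP: no; exists zs.
pose L := size (flatten ys).
have /andP[_ le_L] := size_flatten_letters ysN.
have le_wL : (size w + L <= m * q)%N.
  by apply: leq_trans le_len; rewrite leq_add // ltnW.
(* The first [d] letters of [y] still belong to the factor [chi]. *)
pose d := (m * q - (size w + L))%N.
transitivity ((\sum_(zs <- tuples Z N | letter_count Z N zs == al)
    chi (w ++ flatten zs ++ take d y)) * bcoef S b (drop d y)); last first.
  by rewrite chi_vanish // mul0r.
rewrite mulr_suml [RHS]big_seq_cond; apply: eq_bigr => zs /andP[zsN /eqP c_zs].
have sz_zs : size (w ++ flatten zs) = (size w + L)%N.
  by rewrite size_cat (letter_count_size zsN ysN) // c_zs.
rewrite coefE take_cat drop_cat sz_zs ltnNge le_wL /=.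
by rewrite catA.
Qed.

End Coefficients.

Lemma step_exists : exists T, step n S T.
Proof.
have [t t_gt0 lt_t] := step_parameter.
pose N := (q * t)%N.
pose m := (n + n * N + t)%N.
pose J := {ffun 'I_(size Z) -> 'I_N.+1}.
(* One relation for each offset word [w], monomial [al], partial block [y] and word [g] of full
   blocks. *)
pose C := [seq (x, y) | x <- [seq (w, al) | w <- words_lt n, al <- enum J],
                        y <- [seq (y, g) | y <- words_lt q, g <- words_lt (m - t).+1]].
pose B (e : m.-tuple bool) (x : (seq bool * J) * (seq bool * seq bool)) :=
  \sum_(zs <- tuples Z N | letter_count Z N zs == x.1.2)
    nf S e [::] (x.1.1 ++ flatten zs ++ x.2.1 ++ rep S x.2.2).
have ltC : (size C < #|{: m.-tuple bool}|)%N.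
  rewrite card_tuple card_bool !size_allpairs -cardE card_ffun !card_ord.
  have le_tm : (t <= m)%N by rewrite leq_addl.
  rewrite -[X in (_ < 2 ^ X)%N](subnK le_tm) expnD.
  apply: (@leq_ltn_trans (2 ^ (m - t) * (2 ^ (n + q).+1 * (q * t).+1 ^ size Z))%N); last first.
    by rewrite ltn_mul2l expn_gt0.
  have := leq_mul (ltnW (size_words_lt n)) (leqnn (N.+1 ^ size Z)).
  move=> /leq_mul/(_ (leq_mul (ltnW (size_words_lt q)) (ltnW (size_words_lt (m - t).+1)))).
  move=> /leq_trans; apply; apply: eq_leq; rewrite !expnS expnD; ring.
have [c [[e0 c_e0] c_kills]] := underdetermined B ltC.
apply: (@step_of_coefficients t m c erefl _ e0 c_e0).
  move=> w al y g lt_w lt_y le_g; apply: (c_kills ((w, al), (y, g))).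
  by apply: allpairs_f; apply: allpairs_f; rewrite ?mem_words_lt ?mem_enum.
have : (2 ^ q < 2 ^ t)%N.
  apply: leq_ltn_trans lt_t; rewrite (leq_trans _ (leq_pmulr _ _)) ?expn_gt0 //.
  by rewrite leq_exp2l // leqW // leq_addl.
by rewrite ltn_exp2l // /m; lia.
Qed.

End StepExists.

(** * Nilpotency *)

Section Nil.
Variables (K : fieldType) (n : nat) (S T : block K) (p : seq (K * seq bool)).
Hypotheses (stepST : step n S T) (p_n : degrees_in n p).
Let q := blen T.

Lemma iter_act_list j : exists2 L,
  (forall f, iter j (act p) f = act L f)
  & forall t, t \in L -> (j <= size t.2 <= n * j)%N.
Proof.
have [a actE] := act_letters p_n.
exists [seq (\prod_(z <- zs) a z, flatten zs) | zs <- tuples (letters n) j].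
  by move=> f; apply/funext => u; rewrite (iter_act _ _ _ actE) /act big_map.
by move=> _ /mapP[zs zsj ->] /=; apply: size_flatten_letters.
Qed.

(** At most [q] factors lead across a block boundary, to an offset below [n]; the next [N] are
    killed there, and the last [q] supply the letters that complete the block, so that its rule can
    be applied. *)
Lemma step_nil : exists M, forall F u, aligned T F -> iter M (act p) F u = 0.
Proof.
have [_ _ [N le_N kill]] := stepST; exists (q + (N + q))%N => F u0 alF.
have q_gt0 : (0 < q)%N by apply: blen_gt0.
have base j w : (size w %% q < n)%N -> iter (N + (q + j)) (act p) F w = 0.
  move=> lt_w; have [L LE L_size] := iter_act_list N.
  have [M ME M_size] := iter_act_list (q + j).
  rewrite iterD LE ME /act.
  under eq_bigr => t _ do rewrite mulr_sumr.
  rewrite exchange_big; apply: big1_seq => -[x y] /andP[_ /M_size /= /andP[le_y _]].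
  have {}le_y : (q <= size y)%N by rewrite (leq_trans _ le_y) ?leq_addr.
  pose w1 := take (size w %/ q * q) w; pose w2 := drop (size w %/ q * q) w.
  have sz_w1 : size w1 = (size w %/ q * q)%N by rewrite size_takel ?leq_trunc_div.
  have sz_w2 : size w2 = (size w %% q)%N.
    by rewrite size_drop {1}(divn_eq (size w) q) addKn.
  have le_w2 t : t \in L -> (size w2 + size t.2 <= q)%N.
    by move=> /L_size/andP[_ le_t]; rewrite (leq_trans _ le_N) // sz_w2 leq_add // ltnW.
  (* The number of letters of [y] that complete the block. For a fixed gap [d] the sum may be
     extended to all of [L], since [bcoef] is 0 on other lengths, and then [kill] applies. *)
  pose gap (t : K * seq bool) : 'I_q.+1 := inord (q - (size w2 + size t.2)).
  rewrite (partition_big gap xpredT) //=; apply: big1 => d _.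
  have le_d : (d <= q)%N by rewrite -ltnS.
  transitivity (x * \sum_b (\sum_(t <- L) t.1 * bcoef T b ((w2 ++ t.2) ++ take d y)) *
      F (w1 ++ brep T b ++ drop d y)); last first.
    rewrite big1 ?mulr0 // => b _.
    have := kill p w2 (take d y) b p_n; rewrite sz_w2 LE => /(_ lt_w) kill_b.
    by rewrite [X in X * _]kill_b mul0r.
  under [in RHS]eq_bigr => b _ do rewrite mulr_suml.
  rewrite exchange_big mulr_sumr big_mkcond.
  apply: eq_big_seq => -[c z] Lz /=.
  have := le_w2 _ Lz => /= le_z.
  rewrite /gap -val_eqE /= inordK ?ltnS ?leq_subr //.
  have [eq_d|ne_d] := eqVneq.
    rewrite -{1}(cat_take_drop (size w %/ q * q) w) -/w1 -/w2 -{1}(cat_take_drop d y).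
    rewrite -!catA [z ++ _]catA [w2 ++ _]catA alF ?sz_w1 ?dvdn_mull //; last first.
      by rewrite !size_cat size_takel ?(leq_trans le_d) // -eq_d addnA subnKC.
    rewrite mulrCA; congr (_ * _); rewrite mulr_sumr; apply: eq_bigr => b _.
    by rewrite !mulrA !catA.
  rewrite [X in x * X]big1 ?mulr0 // => b _.
  rewrite bcoef_out ?mulr0 ?mul0r // !size_cat size_takel ?(leq_trans le_d) //.
  by apply: contraNneq ne_d => eq_q; apply/eqP; move: eq_q; rewrite /= -/q; lia.
(* Induction on a bound for the distance to the boundary: each factor has length from 1 to [n], so
   it approaches the boundary or overshoots it by less than [n]. *)
have main d w : (q - size w %% q <= d)%N -> iter (d + (N + q)) (act p) F w = 0.
  elim: d w => [|d IHd] w.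
    by rewrite leqn0 subn_eq0 leqNgt ltn_mod q_gt0.
  move=> le_d; have [lt_w|le_w] := ltnP (size w %% q) n.
    by rewrite addnCA [(d.+1 + q)%N]addnC base.
  rewrite addSn iterS; apply: big1_seq => -[c z] /andP[_ pz] /=.
  have /andP[z_gt0 le_z] := allP p_n _ pz.
  have lt_wq : (size w %% q < q)%N by rewrite ltn_mod.
  have mod_wz : (size (w ++ z) %% q = (size w %% q + size z) %% q)%N.
    by rewrite size_cat modnDml.
  have [lt_q|le_q] := ltnP (size w %% q + size z) q.
    by rewrite IHd ?mulr0 // mod_wz modn_small //; move: z_gt0 => /= ; lia.
  rewrite [(d + _)%N]addnCA [(d + q)%N]addnC base ?mulr0 // mod_wz.
  have le_nq : (n <= q)%N by rewrite (leq_trans _ le_N) ?leq_addr.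
  rewrite -(subnK le_q) modnDr modn_small;
    move: le_z lt_wq le_q le_nq => /=; move: (size w %% q)%N (size z) => a b; lia.
by apply: main; apply: leq_subr.
Qed.

End Nil.

(** * The tower of reductions *)

Section Stages.
Variable K : fieldType.

Let letter_coef (b : bool) (x : seq bool) : K := (x == [:: b])%:R.

Let letter_coef_out b x : size x != 1 -> letter_coef b x = 0.
Proof.
by move=> ne_x; rewrite /letter_coef (_ : (x == _) = false) //; apply: contraNF ne_x => /eqP ->.
Qed.

Let letter_coef_rep b c : letter_coef b [:: c] = (b == c)%:R.
Proof. by rewrite /letter_coef eqseq_cons andbT eq_sym. Qed.

Definition letter_block : block K :=
  @Block K 1 letter_coef (fun b => [:: b]) (ltn0Sn 0) (fun=> erefl) letter_coef_out letter_coef_rep.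

(** The level doubles as the bound on degrees and offsets, so every list is handled at some
    level. *)
Fixpoint stage (k : nat) : block K :=
  if k is k'.+1 then sval (cid (step_exists (stage k') k')) else letter_block.

Lemma stage_step k : step k (stage k) (stage k.+1).
Proof. exact: svalP. Qed.

Lemma blen_stageS k : exists2 m,
  blen (stage k.+1) = (m.+1 * blen (stage k))%N & (blen (stage k) <= m)%N.
Proof. by have [] := stage_step k. Qed.

Lemma ltn_blen_stage k : (k < blen (stage k))%N.
Proof.
elim: k => // k IHk; have [m -> le_m] := blen_stageS k.
by rewrite mulSn; have := blen_gt0 (stage k); nia.
Qed.

Lemma dvdn_blen_stage k l : (k <= l)%N -> (blen (stage k) %| blen (stage l))%N.
Proof.
elim: l => [|l IHl]; first by rewrite leqn0 => /eqP ->.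
rewrite leq_eqVlt => /orP[/eqP -> //|/IHl /dvdn_trans]; apply.
by have [m -> _] := blen_stageS l; rewrite dvdn_mull.
Qed.

Lemma aligned_bcoef (S : block K) b : aligned S (bcoef S b).
Proof.
have -> : bcoef S b = nf S [:: b] [::].
  apply/funext => y /=; have [le_y|gt_y] := leqP (size y) (blen S).
    by rewrite take_oversize // drop_oversize // eqxx mulr1.
  by rewrite bcoef_out ?gtn_eqF // -size_eq0 size_drop gtn_eqF ?mulr0 // subn_gt0.
exact: aligned_nf.
Qed.

Lemma aligned_bcoef_stage k l b : (k <= l)%N -> aligned (stage k) (bcoef (stage l) b).
Proof.
elim: l b => [|l IHl] b; first by rewrite leqn0 => /eqP ->; apply: aligned_bcoef.
rewrite leq_eqVlt => /orP[/eqP ->|le_kl]; first exact: aligned_bcoef.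
have [[m szS _] alS _] := stage_step l.
apply: (@aligned_trans _ (stage l)) => //.
- exact: dvdn_blen_stage.
- by move=> c; apply: IHl.
move=> y nd_y.
apply: bcoef_out; apply: contraNneq nd_y => ->.
by rewrite szS dvdn_mull.
Qed.

Definition coherent (f : seq bool -> K) : Prop := forall k, aligned (stage k) f.

(** Levels up to [k] follow by transitivity. At higher levels both sides vanish, since a word
    containing such a block is too long. *)
Lemma coherent_nf k e :
  (size e * blen (stage k) < blen (stage k.+1))%N -> coherent (nf (stage k) e [::]).
Proof.
move=> lt_e l; have [le_lk|lt_kl] := leqP l k.
  apply: (@aligned_trans _ (stage k)).
  - exact: dvdn_blen_stage.
  - by move=> b; apply: aligned_bcoef_stage.
  - exact: aligned_nf.
  move=> y nd_y.
  by apply: nf_out; apply: contraNneq nd_y => ->; rewrite addn0 dvdn_mull.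
have lt_el : (size e * blen (stage k) < blen (stage l))%N.
  by rewrite (leq_trans lt_e) // dvdn_leq ?blen_gt0 // dvdn_blen_stage.
have out z : (blen (stage l) <= size z)%N -> nf (stage k) e [::] z = 0.
  by move=> le_z; rewrite nf_out // addn0 gtn_eqF // (leq_trans lt_el).
move=> u x v _ sz_x; rewrite out ?big1 // => [b _|].
  by rewrite out ?mulr0 // !size_cat size_brep addnCA leq_addr.
by rewrite !size_cat sz_x addnCA leq_addr.
Qed.

Lemma coherent_shift f v : coherent f -> coherent (fun u => f (u ++ v)).
Proof. by move=> cf k; apply: aligned_catr. Qed.

Lemma coherent_sum (I : eqType) (r : seq I) (c : I -> K) (F : I -> seq bool -> K) :
  (forall i, i \in r -> coherent (F i)) ->
  coherent (fun u => \sum_(i <- r) c i * F i u).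
Proof. by move=> cF k; apply: aligned_sum => i ri; apply: cF. Qed.

Lemma coherent_act p f : coherent f -> coherent (act p f).
Proof. by move=> cf; apply: coherent_sum => t _; apply: coherent_shift. Qed.

(** The rules preserve length; this makes the sum of the degree parts direct. *)
Lemma coherent_component n f :
  coherent f -> coherent (fun u => if size u == n then f u else 0).
Proof.
move=> cf k u x v q_u sz_x /=.
under [RHS]eq_bigr => b _ do rewrite !size_cat size_brep.
rewrite !size_cat sz_x; case: eqP => _; first exact: cf.
by rewrite big1 // => b _; rewrite mulr0.
Qed.

Lemma act_nil p : all (fun t => t.2 != [::]) p ->
  exists M, forall f u, coherent f -> iter M (act p) f u = 0.
Proof.
move=> /allP p_ne; pose n := \max_(t <- p) size t.2.
have p_n : degrees_in n p.
  apply/allP => t pt; rewrite lt0n size_eq0 p_ne //=.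
  exact: (@leq_bigmax_seq _ p xpredT (fun t => size t.2)).
have [M MP] := step_nil (stage_step n) p_n.
by exists M => f u cf; apply: MP.
Qed.

End Stages.

(** * The algebra and its grading *)

Section Algebra.
Variable K : fieldType.

Definition fop := (seq bool -> K) -> seq bool -> K^o.

(* The value [0] outside the coherent functions makes [op p] depend on [p] only
   through its action on the coherent ones. *)
Definition op (p : seq (K * seq bool)) : fop :=
  fun f u => if `[< coherent f >] then act p f u else 0.

Definition nonconstant (p : seq (K * seq bool)) : bool := all (fun t => t.2 != [::]) p.

Definition pscale (k : K) (p : seq (K * seq bool)) := [seq (k * t.1, t.2) | t <- p].

Definition pmul (p q : seq (K * seq bool)) :=
  [seq (s.1 * t.1, s.2 ++ t.2) | s <- p, t <- q].

Lemma act_pmul p q f : act (pmul p q) f = act p (act q f).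
Proof.
apply/funext => u; rewrite /act big_allpairs_dep; apply: eq_bigr => s _.
by rewrite mulr_sumr; apply: eq_bigr => t _; rewrite mulrA catA.
Qed.

Lemma coherent_linear (k : K) (f g : seq bool -> K) : coherent f -> coherent g ->
  coherent (fun u => k * f u + g u).
Proof.
move=> cf cg l u x v q_u sz_x; rewrite (cf l) // (cg l) // mulr_sumr -big_split.
by apply: eq_bigr => b _; rewrite mulrDr mulrCA.
Qed.

Lemma coherent0 : coherent (fun=> 0 : K).
Proof. by move=> k u x v _ _; rewrite big1 // => b _; rewrite mulr0. Qed.

Lemma op_coherent p f : coherent f -> op p f = act p f.
Proof. by move=> cf; apply/funext => u; rewrite /op asboolT. Qed.

Lemma op_incoherent p f : ~ coherent f -> op p f = 0.
Proof. by move=> cf; apply/funext => u; rewrite /op asboolF. Qed.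

Lemma coherent_op p f : @coherent K (op p f).
Proof.
have [cf|cf] := pselect (coherent f).
  by rewrite op_coherent //; apply: coherent_act.
by rewrite op_incoherent //; apply: coherent0.
Qed.

Lemma op_linear p k (f g : seq bool -> K) : coherent f -> coherent g ->
  op p (fun u => k * f u + g u) = k *: op p f + op p g.
Proof.
move=> cf cg; rewrite (op_coherent _ (coherent_linear k cf cg)) !op_coherent //.
apply/funext => u; rewrite -[RHS]/(k * act p f u + act p g u).
rewrite /act mulr_sumr -big_split; apply: eq_bigr => t _.
by rewrite mulrDr mulrCA.
Qed.

Lemma op_scale_cat k p q : op (pscale k p ++ q) = k *: op p + op q.
Proof.
apply/funext => f; apply/funext => u.
rewrite -[RHS]/(k * op p f u + op q f u) /op.
case: asboolP => _; last by rewrite mulr0 addr0.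
rewrite /act big_cat big_map mulr_sumr; congr (_ + _).
by apply: eq_bigr => t _; rewrite mulrA.
Qed.

Lemma op_nil : op [::] = 0.
Proof. by apply/funext => f; apply/funext => u; rewrite /op /act big_nil if_same. Qed.

Lemma op_pmul p q : op (pmul p q) = op p \o op q.
Proof.
apply/funext => f /=; have [cf|cf] := pselect (coherent f).
  by rewrite (op_coherent _ cf) act_pmul !op_coherent //; apply: coherent_act.
rewrite !(op_incoherent _ cf) op_coherent; last exact: coherent0.
by apply/funext => u; rewrite /act big1 // => t _; rewrite mulr0.
Qed.

(** The augmentation ideal of the free algebra, modulo what acts as zero on the coherent
    functions. *)
Definition representable : pred fop :=
  fun T => `[< exists2 p, nonconstant p & T = op p >].

Lemma representable_submod : GRing.submod_closed representable.
Proof.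
split; first by apply/asboolP; exists [::]; rewrite ?op_nil.
move=> k _ _ /asboolP[p p1 ->] /asboolP[q q1 ->]; apply/asboolP.
exists (pscale k p ++ q); last by rewrite op_scale_cat.
by rewrite /nonconstant all_cat all_map [X in X && _]p1.
Qed.

Record nil_alg := NilAlg { nil_val : fop; nil_valP : representable nil_val }.

HB.instance Definition _ := [isSub for nil_val].
HB.instance Definition _ := [Choice of nil_alg by <:].
HB.instance Definition _ := GRing.SubChoice_isSubLmodule.Build K fop representable
  nil_alg representable_submod.

Lemma representable_comp T U : representable T -> representable U -> representable (T \o U).
Proof.
move=> /asboolP[p p1 ->] /asboolP[q q1 ->]; apply/asboolP.
exists (pmul p q); last by rewrite op_pmul.
apply/allP => _ /allpairsP[[s t] [/= /(allP p1) + _ ->]] /=.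
by case: (s.2).
Qed.

Definition nil_mul (a b : nil_alg) : nil_alg :=
  NilAlg (representable_comp (nil_valP a) (nil_valP b)).

Lemma nil_mulA : associative nil_mul.
Proof. by move=> a b c; apply: val_inj. Qed.

HB.instance Definition _ := isSemigroup.Build nil_alg nil_mulA.

Lemma nil_valD (a b : nil_alg) : nil_val (a + b) = nil_val a + nil_val b.
Proof. by []. Qed.

Lemma nil_valZ k (a : nil_alg) : nil_val (k *: a) = k *: nil_val a.
Proof. by []. Qed.

Lemma nil_valM (a b : nil_alg) : nil_val (a * b)%g = nil_val a \o nil_val b.
Proof. by []. Qed.

Lemma nil_val_op (a : nil_alg) : exists2 p, nonconstant p & nil_val a = op p.
Proof. exact/asboolP/nil_valP. Qed.

Lemma nil_val_linear (a : nil_alg) k (f g : seq bool -> K) : coherent f -> coherent g ->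
  nil_val a (fun u => k * f u + g u) = k *: nil_val a f + nil_val a g.
Proof. by have [p _ ->] := nil_val_op a; apply: op_linear. Qed.

Lemma coherent_nil_val (a : nil_alg) f : @coherent K (nil_val a f).
Proof. by have [p _ ->] := nil_val_op a; apply: coherent_op. Qed.

Let nil_mulDl (a b c : nil_alg) : ((a + b)%R * c)%g = (a * c)%g + (b * c)%g.
Proof. exact: val_inj. Qed.

Let nil_mulZl k (a b : nil_alg) : ((k *: a)%R * b)%g = k *: (a * b)%g.
Proof. exact: val_inj. Qed.

(** Elements of [fop] need not be additive, but [nil_val b f] and [nil_val c f] are coherent, and on
    coherent functions [nil_val a] is linear. *)
Let nil_mulDr (a b c : nil_alg) : (a * (b + c)%R)%g = (a * b)%g + (a * c)%g.
Proof.
apply: val_inj; apply/funext => f.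
transitivity (nil_val a (fun u => 1 * (nil_val b f : _ -> K) u + (nil_val c f : _ -> K) u)).
  by congr (nil_val a _); apply/funext => u; rewrite mul1r.
by rewrite nil_val_linear ?scale1r //; apply: coherent_nil_val.
Qed.

Let nil_mulZr k (a b : nil_alg) : (a * (k *: b)%R)%g = k *: (a * b)%g.
Proof.
apply: val_inj; apply/funext => f.
transitivity (nil_val a (fun u => k * (nil_val b f : _ -> K) u + (fun=> 0) u)).
  by congr (nil_val a _); apply/funext => u; rewrite addr0.
rewrite nil_val_linear; [|exact: coherent_nil_val|exact: coherent0].
have -> : nil_val a (fun=> 0) = 0.
  have [p _ ->] := nil_val_op a; rewrite op_coherent; last exact: coherent0.
  by apply/funext => u; rewrite /act big1 // => t _; rewrite mulr0.
by rewrite addr0.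
Qed.

HB.instance Definition _ := Lmodule_Semigroup_isNUAlgebra.Build K nil_alg
  nil_mulDl nil_mulDr nil_mulZl nil_mulZr.

Lemma nil_alg_nil : nil_algebra nil_alg.
Proof.
move=> a; have [p p1 aE] := nil_val_op a; have [M MP] := act_nil p1.
exists M; apply: val_inj; apply/funext => f.
have powE j : nil_val (pospow a j) f = if `[< coherent f >] then iter j.+1 (act p) f else 0.
  elim: j => [|j IHj].
    rewrite -[pospow a 0]/a aE; case: asboolP => cf; first by rewrite op_coherent.
    by rewrite op_incoherent.
  have -> : nil_val (pospow a j.+1) f = nil_val a (nil_val (pospow a j) f) by [].
  rewrite IHj aE; case: asboolP => cf.
    rewrite op_coherent //=; elim: j {IHj} => [|j IHj]; exact: coherent_act.
  rewrite op_coherent; last exact: coherent0.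
  by apply/funext => u; rewrite /act big1 // => t _; rewrite mulr0.
(* [pospow a M] is the power [M.+1]; the extra factor is absorbed into the coherent function. *)
rewrite [LHS]powE; case: asboolP => // cf; rewrite iterSr.
by apply/funext => u; apply: MP; apply: coherent_act.
Qed.

End Algebra.

(** * The grading by word length and the two generators *)

Section Grading.
Variable K : fieldType.
Notation A := (nil_alg K).

(** Excluding the empty word makes the part of degree 0 zero. *)
Definition homogeneous (i : nat) (p : seq (K * seq bool)) : bool :=
  all (fun t => (t.2 != [::]) && (size t.2 == i)) p.

Lemma homogeneous_nonconstant i p : homogeneous i p -> nonconstant p.
Proof. by apply: sub_all => t /andP[]. Qed.

Definition degree_part (i : nat) : {pred A} :=
  fun a => `[< exists2 p, homogeneous i p & nil_val a = op p >].

Lemma degree_partP i (a : A) :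
  reflect (exists2 p, homogeneous i p & nil_val a = op p) (a \in degree_part i).
Proof. exact: asboolP. Qed.

Lemma representable_op p : nonconstant p -> representable (@op K p).
Proof. by move=> p1; apply/asboolP; exists p. Qed.

Definition nil_op p (p1 : nonconstant p) : A := NilAlg (representable_op p1).

Lemma degree_part_op i p (p1 : nonconstant p) :
  homogeneous i p -> nil_op p1 \in degree_part i.
Proof. by move=> p_i; apply/degree_partP; exists p. Qed.

Lemma degree_part_submod i : GRing.submod_closed (degree_part i).
Proof.
split; first by apply/degree_partP; exists [::]; rewrite ?op_nil.
move=> k a b /degree_partP[p p1 aE] /degree_partP[q q1 bE]; apply/degree_partP.
exists (pscale k p ++ q); last by rewrite op_scale_cat -aE -bE.
by rewrite /homogeneous all_cat all_map [X in X && _]p1.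
Qed.

Lemma degree_partM i j : {in degree_part i & degree_part j, forall a b : A,
  (a * b)%g \in degree_part (i + j)%N}.
Proof.
move=> a b /degree_partP[p p1 aE] /degree_partP[q q1 bE]; apply/degree_partP.
exists (pmul p q); last by rewrite op_pmul -aE -bE.
apply/allP => _ /allpairsP[[s t] [/= /(allP p1)/andP[s1 /eqP <-] /(allP q1)/andP[_ /eqP <-] ->]] /=.
by rewrite size_cat eqxx andbT; case: (s.2) s1.
Qed.

Lemma act_components n (p : seq (K * seq bool)) f u : all (fun t => size t.2 < n)%N p ->
  act p f u = \sum_(i < n) act [seq t <- p | size t.2 == i] f u.
Proof.
move=> /allP p_n; under eq_bigr => i _ do rewrite /act big_filter.
rewrite (exchange_big_dep xpredT) //=; apply: eq_big_seq => t pt.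
by rewrite (big_pred1 (Ordinal (p_n _ pt))).
Qed.

Lemma nil_val_sum n (F : 'I_n -> A) f u :
  nil_val (\sum_(i < n) F i) f u = \sum_(i < n) nil_val (F i) f u.
Proof. by elim/big_rec2: _ => // i y x _ <-. Qed.

Lemma homogeneous_filter i p : nonconstant p ->
  homogeneous i [seq t <- p | size t.2 == i].
Proof. by rewrite /homogeneous all_filter; apply: sub_all => t /= ->; apply/implyP. Qed.

Lemma degree_part_decomposition (a : A) : exists (n : nat) (f : nat -> A),
  (forall i, f i \in degree_part i) /\ a = \sum_(i < n) f i.
Proof.
have [p p1 aE] := nil_val_op a.
have hp i := homogeneous_filter i p1.
exists (\max_(t <- p) size t.2).+1.
exists (fun i => nil_op (homogeneous_nonconstant (hp i))); split.
  by move=> i; apply: degree_part_op.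
apply: val_inj; apply/funext => f; apply/funext => u; rewrite [RHS]nil_val_sum.
rewrite [LHS](congr1 (fun T => T f u) aE) /= /op; case: asboolP => cf; last by rewrite big1.
rewrite -act_components //; apply/allP => t pt.
by rewrite ltnS (@leq_bigmax_seq _ p xpredT (fun t => size t.2)).
Qed.

Lemma act_component i j p (f : seq bool -> K) u : homogeneous j p ->
  act p (fun v => if size v == (size u + i)%N then f v else 0) u =
  if j == i then act p f u else 0.
Proof.
move=> /allP p_j; rewrite /act; case: eqP => [<-|/eqP ne_ij].
  apply: eq_big_seq => t /p_j /andP[_ /eqP sz_t].
  by rewrite size_cat sz_t eqxx.
apply: big1_seq => t /p_j /andP[_ /eqP sz_t].
by rewrite size_cat sz_t eqn_add2l (negPf ne_ij) mulr0.
Qed.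

(** Evaluating at [u] on the part of [g] supported in length [size u + i] isolates the summand of
    degree [i]. *)
Lemma degree_part_direct n (f : nat -> A) : (forall i, f i \in degree_part i) ->
  \sum_(i < n) f i = 0 -> forall i, (i < n)%N -> f i = 0.
Proof.
move=> fP f0 i lt_i; apply: val_inj; apply/funext => g; apply/funext => u.
have [p p_i fE] := degree_partP _ _ (fP i).
rewrite [LHS](congr1 (fun T => T g u) fE) /op; case: asboolP => // cg.
pose h v := if size v == (size u + i)%N then g v else 0.
have ch : coherent h by apply: coherent_component.
have := congr1 (fun a : A => nil_val a h u) f0.
rewrite nil_val_sum (bigD1 (Ordinal lt_i)) //= big1 => [|j ne_j].
  by rewrite addr0 fE op_coherent // (act_component i g u p_i) eqxx.
have [q q_j ->] := degree_partP _ _ (fP j).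
by rewrite op_coherent // (act_component i g u q_j) ifN.
Qed.

Lemma degree_part_grading : grading degree_part.
Proof.
split; [exact: degree_part_submod|exact: degree_partM|
  exact: degree_part_decomposition|exact: degree_part_direct].
Qed.

Definition gen (b : bool) : A := nil_op (p := [:: (1, [:: b])]) isT.

Lemma gen_degree b : gen b \in degree_part 1.
Proof. exact: degree_part_op. Qed.

Lemma gen_generated : generated_by2 (gen true) (gen false).
Proof.
move=> S [[S0 Slin] Smul] Sx Sy.
have Sgen b : gen b \in S by case: b.
have Sword w (w1 : nonconstant [:: (1, w)]) : nil_op w1 \in S.
  elim: w w1 => // b [|c w] IHw w1.
    by rewrite (_ : nil_op w1 = gen b) //; apply: val_inj.
  have w1' : nonconstant [:: (1 : K, c :: w)] by [].
  rewrite (_ : nil_op w1 = (gen b * nil_op w1')%g); first exact: Smul.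
  apply: val_inj; rewrite [RHS]nil_valM /= -op_pmul /pmul /=.
  by rewrite mul1r.
have Sop p (p1 : nonconstant p) : nil_op p1 \in S.
  elim: p p1 => [|t p IHp] p1.
    by rewrite (_ : nil_op p1 = 0) //; apply: val_inj; rewrite /= op_nil.
  have /andP[t1 p1'] := p1.
  have t1' : nonconstant [:: (1 : K, t.2)] by rewrite /nonconstant /= t1.
  rewrite (_ : nil_op p1 = t.1 *: nil_op t1' + nil_op p1'); first exact: Slin.
  apply: val_inj; rewrite [RHS]nil_valD nil_valZ /= -op_scale_cat /=.
  by rewrite mulr1 -surjective_pairing.
move=> a; have [p p1 aE] := nil_val_op a.
by rewrite (_ : a = nil_op p1) //; apply: val_inj.
Qed.

End Grading.

(** * Growth *)

Section Dimension.
Variables (K : fieldType) (V : lmodType K).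

Definition independent m (b : 'I_m -> V) : Prop :=
  forall c : 'I_m -> K, \sum_i c i *: b i = 0 -> forall i, c i = 0.

Lemma dimension_spec (W : set V) D :
    W 0 -> (forall k u v, W u -> W v -> W (k *: u + v)) ->
    (forall m (b : 'I_m -> V), (forall i, W (b i)) -> independent b -> (m <= D)%N) ->
  (dimension W <= D)%N /\
  forall m (b : 'I_m -> V), (forall i, W (b i)) -> independent b ->
    (m <= dimension W)%N.
Proof.
move=> W0 Wlin bound.
pose P m := `[< exists b : 'I_m -> V, (forall i, W (b i)) /\ independent b >].
have P0 : exists m, P m.
  by exists 0; apply/asboolP; exists (fun=> 0); split => // c _ [].
have Pbound m : P m -> (m <= D)%N by move=> /asboolP[b [bW bI]]; apply: bound bI.
have [m /asboolP[b [bW bI]] m_max] := ex_maxnP P0 Pbound.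
have dimP : has_dim W m.
  exists b; split=> //; apply/seteqP; split=> [v Wv|_ [c ->]]; last first.
    by elim/big_rec: _ => // i x _ Wx; apply: Wlin.
  apply: contrapT => v_out.
  suff : P m.+1 by move=> /m_max; rewrite ltnn.
  apply/asboolP; exists (fun i => if unlift ord0 i is Some j then b j else v).
  split=> [i|c]; first by case: unliftP.
  rewrite big_ord_recl unlift_none; under eq_bigr => i _ do rewrite liftK.
  move=> c0; have c00 : c ord0 = 0.
    apply: contrapT => /eqP c_neq0; apply: v_out.
    exists (fun i => - (c ord0)^-1 * c (lift ord0 i)).
    under eq_bigr => i _ do rewrite -scalerA.
    rewrite -scaler_sumr; move/eqP: c0; rewrite addrC addr_eq0 => /eqP ->.
    by rewrite scalerN scaleNr opprK scalerA mulVf // scale1r.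
  move: c0; rewrite c00 scale0r add0r => /bI cb i.
  by have [j ->|->] := unliftP ord0 i.
have [B [BI WB]] : has_dim W (dimension W) by apply: getPex; exists m.
have BW i : W (B i).
  rewrite WB; exists (fun j => (j == i)%:R).
  by rewrite (bigD1 i) //= eqxx scale1r big1 ?addr0 // => j /negPf ->; rewrite scale0r.
split; first exact: bound BI.
move=> l a aW aI; rewrite leqNgt; apply/negP => lt_l.
have /choice[C CE] : forall i, exists c : 'I_(dimension W) -> K, a i = \sum_j c j *: B j.
  by move=> i; have := aW i; rewrite {1}WB.
have := @underdetermined K 'I_l _ (enum 'I_(dimension W)) (fun i j => C i j).
rewrite size_enum_ord card_ord => /(_ lt_l)[c [[i ci] cC]].
have : c i = 0.
  apply: aI; under eq_bigr => h _ do rewrite CE scaler_sumr.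
  rewrite exchange_big big1 // => j _; under eq_bigr => h _ do rewrite scalerA.
  by rewrite -scaler_suml cC ?scale0r ?mem_enum.
by rewrite ci => /eqP; rewrite oner_eq0.
Qed.

End Dimension.

(** * Upper and lower bounds on the dimensions *)

Section Growth.
Variable K : fieldType.
Notation A := (nil_alg K).
Notation G := (@degree_part K).

Lemma degree_le0 n : degree_le G n (0 : A).
Proof.
exists (fun=> 0); split; last by rewrite big1.
by move=> i; case: (degree_part_submod K i).
Qed.

Lemma degree_le_linear n k (a b : A) :
  degree_le G n a -> degree_le G n b -> degree_le G n (k *: a + b).
Proof.
move=> [f [fG ->]] [g [gG ->]]; exists (fun i => k *: f i + g i); split.
  by move=> i; case: (degree_part_submod K i) => _; apply.
by rewrite big_split scaler_sumr.
Qed.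

Lemma degree_le_op n (a : A) : degree_le G n a ->
  exists2 p, all (fun t => size t.2 <= n)%N p & nil_val a = op p.
Proof.
move=> [f [fG ->]]; have: (n.+1 <= n.+1)%N by [].
elim: {-2}n.+1 => [|j IHj] lt_j.
  by exists [::]; rewrite // big_ord0 op_nil.
have [p p_n pE] := IHj (ltnW lt_j).
have [q q_j qE] := degree_partP _ _ (fG j).
exists (pscale 1 p ++ q).
  rewrite all_cat all_map [X in X && _]p_n /=.
  by apply: sub_all q_j => t /andP[_ /eqP ->].
by rewrite big_ord_recr op_scale_cat -pE -qE scale1r.
Qed.

(** The action of [p] is determined by the finitely many numbers [act p (nf S e s) u2], which
    involve neither [g] nor [u1]. *)
Lemma act_expand (S : block K) Q n p g u1 u2 :
    all (fun t => size t.2 <= n)%N p -> (n + blen S <= Q * blen S)%N ->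
    aligned S g -> (blen S %| size u1)%N -> (size u2 < blen S)%N ->
  act p g (u1 ++ u2) =
  \sum_(e <- words_lt Q) \sum_(s <- words_lt (blen S))
    act p (nf S e s) u2 * g (u1 ++ rep S e ++ s).
Proof.
move=> /allP p_n le_n alg q_u1 lt_u2.
under [RHS]eq_bigr => e _ do under eq_bigr => s _ do rewrite mulr_suml.
under [RHS]eq_bigr => e _ do rewrite exchange_big.
rewrite exchange_big; apply: eq_big_seq => t /p_n le_t /=.
rewrite -catA (aligned_expand (Q := Q) (aligned_catl q_u1 alg)); last first.
  by rewrite size_cat; apply: leq_trans le_n; rewrite addnC -addnS leq_add.
rewrite mulr_sumr; apply: eq_bigr => e _; rewrite mulr_sumr.
by apply: eq_bigr => s _; rewrite mulrA.
Qed.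

(** By [act_expand], fewer than [2 ^ (2 * q + Q)] numbers determine an element; a larger family has
    a nontrivial combination for which they all vanish. *)
Lemma degree_le_bound k Q n : (n + blen (stage K k) <= Q * blen (stage K k))%N ->
  forall m (b : 'I_m -> A), (forall i, degree_le G n (b i)) -> independent b ->
    (m <= 2 ^ (2 * blen (stage K k) + Q))%N.
Proof.
set S := stage K k; set q := blen S => le_n m b bW bI.
rewrite leqNgt; apply/negP => lt_m.
have /choice[p pP] : forall i, exists p,
    all (fun t => size t.2 <= n)%N p /\ nil_val (b i) = op p.
  by move=> i; have [p] := degree_le_op (bW i); exists p.
pose tests := [seq (u, es) | u <- words_lt q,
    es <- [seq (e, s) | e <- words_lt Q, s <- words_lt q]].
have lt_tests : (size tests < #|'I_m|)%N.
  rewrite card_ord !size_allpairs; apply: leq_ltn_trans lt_m.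
  rewrite mul2n -addnn -addnA expnD leq_mul ?(ltnW (size_words_lt q)) //.
  by rewrite addnC expnD leq_mul // ltnW // size_words_lt.
have [c [[i ci] c0]] := underdetermined
  (fun i (x : seq bool * (seq bool * seq bool)) => act (p i) (nf S x.2.1 x.2.2) x.1) lt_tests.
have : c i = 0.
  apply: bI; apply: val_inj; apply/funext => g; apply/funext => u.
  rewrite [LHS]nil_val_sum.
  transitivity (\sum_j c j * op (p j) g u).
    by apply: eq_bigr => j _; rewrite nil_valZ (pP j).2.
  have [cg|cg] := pselect (coherent g); last first.
    by rewrite big1 // => j _; rewrite op_incoherent // mulr0.
  pose u1 := take (size u %/ q * q) u; pose u2 := drop (size u %/ q * q) u.
  have q_u1 : (q %| size u1)%N by rewrite size_takel ?leq_trunc_div // dvdn_mull.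
  have lt_u2 : (size u2 < q)%N.
    by rewrite size_drop {1}(divn_eq (size u) q) addKn ltn_mod blen_gt0.
  transitivity (\sum_j \sum_(e <- words_lt Q) \sum_(s <- words_lt q)
      c j * act (p j) (nf S e s) u2 * g (u1 ++ rep S e ++ s)).
    apply: eq_bigr => j _; rewrite op_coherent // -[u](cat_take_drop (size u %/ q * q)).
    rewrite (act_expand (pP j).1 le_n (cg k) q_u1 lt_u2) mulr_sumr.
    apply: eq_bigr => e _; rewrite mulr_sumr; apply: eq_bigr => s _.
    by rewrite mulrA.
  rewrite exchange_big; apply: big1_seq => e /andP[_ Qe].
  rewrite exchange_big; apply: big1_seq => s /andP[_ qs].
  rewrite -mulr_suml (c0 (u2, (e, s))) ?mul0r //.
  by apply: allpairs_f; rewrite ?mem_words_lt //; apply: allpairs_f.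
by rewrite ci => /eqP; rewrite oner_eq0.
Qed.

Lemma dimension_le k Q n : (n + blen (stage K k) <= Q * blen (stage K k))%N ->
  (dimension (degree_le G n) <= 2 ^ (2 * blen (stage K k) + Q))%N.
Proof.
move=> le_n; apply: (dimension_spec _ _ (degree_le_bound le_n)).1.
- exact: degree_le0.
- by move=> c a b; apply: degree_le_linear.
Qed.

(** The [2 ^ t] words [rep S e] are separated by the functions [nf S e [::]], coherent because the
    next level is longer. *)
Lemma dimension_ge k t : (0 < t)%N -> (t * blen (stage K k) < blen (stage K k.+1))%N ->
  (2 ^ t <= dimension (degree_le G (t * blen (stage K k))))%N.
Proof.
set S := stage K k; set q := blen S => t_gt0 lt_t.
(* Level 0 already gives the finite bound that [dimension_spec] asks for. *)
have bound : (t * q + blen (stage K 0) <= (t * q).+1 * blen (stage K 0))%N.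
  by rewrite muln1 addn1.
have tq_gt0 : (0 < t * q)%N by rewrite muln_gt0 t_gt0 blen_gt0.
pose E : finType := t.-tuple bool.
have pE (e : E) : homogeneous (t * q) [:: (1 : K, rep S e)].
  by rewrite /homogeneous /= -size_eq0 size_rep size_tuple eqxx -lt0n tq_gt0.
pose b (i : 'I_#|E|) := nil_op (homogeneous_nonconstant (pE (enum_val i))).
suff : (#|E| <= dimension (degree_le G (t * q)))%N by rewrite card_tuple card_bool.
apply: ((dimension_spec _ _ (degree_le_bound bound)).2 _ b).
- exact: degree_le0.
- by move=> c a a'; apply: degree_le_linear.
- move=> i; exists (fun j => if j == (t * q)%N then b i else 0); split=> [j|].
    case: eqP => [->|_]; first exact: degree_part_op.
    by case: (degree_part_submod K j).
  by rewrite big_ord_recr /= eqxx big1 ?add0r // => j _; rewrite ltn_eqF.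
move=> c c0 i.
pose f := nf S (enum_val i : E) [::].
have cf : coherent f by apply: coherent_nf; rewrite size_tuple.
have b_f j : nil_val (c j *: b j) f [::] = c j * (i == j)%:R.
  rewrite nil_valZ -[LHS]/(c j * op [:: (1, rep S (enum_val j : E))] f [::]).
  rewrite op_coherent // /act big_seq1 mul1r /f /= -[rep _ _]cats0 nf_rep ?size_tuple //.
  by rewrite andbT val_eqE (inj_eq enum_val_inj).
have := congr1 (fun a : A => nil_val a f [::]) c0.
rewrite nil_val_sum (bigD1 i) // big1 => [|j ne_j]; last first.
  by rewrite b_f eq_sym (negPf ne_j) mulr0.
rewrite b_f => ci0; have {ci0} : c i * (i == i)%:R + 0 = 0 := ci0.
by rewrite eqxx mulr1 addr0.
Qed.

End Growth.

(** * Intermediate growth *)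

Lemma not_polynomial_growth (R : realType) (K : fieldType) :
  ~ polynomial_growth R (@degree_part K).
Proof.
move=> [C [d [C_gt0 _ growth]]].
pose c := (Num.truncn C).+1; pose D := (Num.truncn d).+1.
(* Chosen so that [c * m ^ (2 * D) < 2 ^ m] whenever [k <= m]. The exponent is doubled because
   [q <= m] gives [(m * q) ^ D <= m ^ (2 * D)]. *)
pose k := ((2 * D).+1 * (c * (2 * D).+1 ^ (2 * D)))%N.
set q := blen (stage K k).
have [m szS le_qm] := blen_stageS K k.
have lt_km : (k < m)%N := leq_trans (ltn_blen_stage K k) le_qm.
have m_gt0 : (0 < m)%N by apply: leq_ltn_trans lt_km.
have mq_gt0 : (0 < m * q)%N by rewrite muln_gt0 m_gt0 blen_gt0.
have lt_mq : (m * q < blen (stage K k.+1))%N.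
  by rewrite szS ltn_mul2r blen_gt0 ltnSn.
have := exp2_dominates_pow (ltnW lt_km); apply/negP; rewrite -leqNgt.
apply: leq_trans (dimension_ge m_gt0 lt_mq) _.
rewrite -(ler_nat R); apply: le_trans (growth _ mq_gt0) _.
rewrite [leRHS]natrM ler_pM ?powR_ge0 ?(ltW C_gt0) ?(ltW (truncnS_gt C)) //.
apply: (@le_trans _ _ ((m * q)%:R `^ D%:R)).
  by rewrite ler_powR ?ler1n // ltW // truncnS_gt.
by rewrite powR_mulrn // -natrX ler_nat expnM leq_exp2r // -mulnn leq_mul2l le_qm orbT.
Qed.

Lemma not_exponential_growth (R : realType) (K : fieldType) :
  ~ exponential_growth R (@degree_part K).
Proof.
move=> [c [c_gt1 [N _ growth]]].
have c_ge0 : 0 <= c by rewrite ltW // (lt_trans ltr01).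
have [M c_M] : exists M, 4 <= c ^+ M.
  pose x := c - 1; have x_gt0 : 0 < x by rewrite subr_gt0.
  have bern M : 1 + M%:R * x <= c ^+ M.
    elim: M => [|M IHM]; first by rewrite mul0r addr0 expr0.
    rewrite exprS; apply: le_trans (ler_wpM2l c_ge0 IHM).
    have -> : c = 1 + x by rewrite addrC subrK.
    rewrite -[M.+1]addn1 natrD; have : 0 <= M%:R * x * x by rewrite !mulr_ge0 // ltW.
    lra.
  exists (Num.truncn (3 / x)).+1; apply: le_trans (bern _).
  have : 3 / x < (Num.truncn (3 / x)).+1%:R by apply: truncnS_gt.
  by rewrite ltr_pdivrMr //; lra.
set q := blen (stage K M).
have c_q : 4 <= c ^+ q.
  by apply: le_trans c_M _; rewrite ler_weXn2l ?(ltW c_gt1) // ltnW // ltn_blen_stage.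
(* Then [2 * q + Q.+1 <= 2 * Q], so the dimension is at most [4 ^ Q <= c ^ n]; the summand [N] puts
   [n] beyond the threshold. *)
pose Q := (2 * q + 2 + N)%N; pose n := (Q * q)%N.
have le_Nn : (N <= n)%N.
  by rewrite (leq_trans _ (leq_pmulr _ (blen_gt0 _))) // leq_addl.
have le_nq : (n + q <= Q.+1 * q)%N by rewrite mulSn addnC.
have := growth n le_Nn; apply/negP; rewrite -leNgt.
apply: (@le_trans _ _ (2 ^ (2 * q + Q.+1))%N%:R).
  by rewrite ler_nat; apply: dimension_le.
rewrite /n [(Q * q)%N]mulnC exprM natrX; apply: le_trans (_ : 4 ^+ Q <= _).
  have -> : 4 = 2 ^+ 2 :> R by rewrite -natrX.
  by rewrite -exprM ler_weXn2l ?ler1n // /Q; lia.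
by rewrite lerXn2r // nnegrE ?exprn_ge0.
Qed.

Theorem corollary3p5 (R : realType) (K : fieldType) :
  exists (A : nuAlgType K) (G : nat -> {pred A}),
    [/\ grading G,
        nil_algebra A,
        exists x y : A,
          [/\ x \in G 1%N, y \in G 1%N & generated_by2 x y],
        ~ polynomial_growth R G
      & ~ exponential_growth R G].
Proof.
exists (nil_alg K : nuAlgType K), (@degree_part K); split.
- exact: degree_part_grading.
- exact: nil_alg_nil.
- by exists (gen K true), (gen K false); split; [exact: gen_degree..|exact: gen_generated].
- exact: not_polynomial_growth.
- exact: not_exponential_growth.
Qed.
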